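(* If $K$ is a compact Hausdorff space and $\mu\in P(K)$, then $\chi(\mu,P(K))=\operatorname{sd}(\mu)$.
   Context: For a compact Hausdorff space $K$, a Radon measure on $K$ is a finite Borel measure $\mu$ with $\mu(B)=\sup\{\mu(F): F \text{ closed}, F\subseteq B\}$ for every Borel $B\subseteq K$. $P(K)$ is the set of all Radon probability measures on $K$ with the weak$^*$ topology inherited from $C(K)^*$. A measure $\mu\in P(K)$ is strongly $\kappa$-determined if there is a continuous map $f:K\to[0,1]^\kappa$ such that $\mu(F)=\mu(f^{-1}[f[F]])$ for every compact set $F\subseteq K$. $\operatorname{sd}(\mu)$ is the least infinite cardinal $\kappa$ for which $\mu$ is strongly $\kappa$-determined. For a topological space $X$ and $x\in X$, $\chi(x,X)$ is the least infinite cardinal $\kappa$ such that $X$ has a local base at $x$ of cardinality at most $\kappa$ (so finite values are counted as $\omega$). *)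

(* Defs.v *)
From HB Require Import structures.
From mathcomp Require Import all_boot all_order all_algebra.
From mathcomp Require Import all_classical all_reals all_analysis.

Set Implicit Arguments.
Unset Strict Implicit.
Unset Printing Implicit Defensive.

Import Order.TTheory GRing.Theory Num.Theory numFieldNormedType.Exports.

Local Open Scope classical_set_scope.
Local Open Scope card_scope.
Local Open Scope ring_scope.
Local Open Scope ereal_scope.

(* A cardinal is represented by a type, up to equinumerosity: the least
   infinite cardinal satisfying [P] is unique up to bijection. *)
Definition least_infinite_cardinal (P : Type -> Prop) (kappa : Type) : Prop :=
  [/\ infinite_set [set: kappa], P kappa &
      forall lambda : Type, infinite_set [set: lambda] -> P lambda ->
        [set: kappa] #<= [set: lambda]].

Section character.
Context {X : topologicalType}.

Definition local_base (x : X) (B : set (set X)) : Prop :=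
  B `<=` open_nbhs x /\ filter_from B id --> x.

(* chi(x, X) = kappa *)
Definition is_character (x : X) (kappa : Type) : Prop :=
  least_infinite_cardinal
    (fun lambda => exists2 B, local_base x B & B #<= [set: lambda]) kappa.

End character.

(* The library's measurable spaces are pointed, hence so is the space; this
   excludes only the empty space, which carries no probability measure. *)
Notation borel K := (g_sigma_algebraType (@open K)).

Definition radon (R : realType) (K : ptopologicalType)
    (mu : set (borel K) -> \bar R) : Prop :=
  forall B : set (borel K), measurable B ->
    mu B = ereal_sup [set mu F | F in [set F : set K | closed F /\ F `<=` B]].

Definition radon_probability (R : realType) (K : ptopologicalType) :=
  set_type [set mu : probability (borel K) R | radon mu].

(* The functional on C(K) induced by [mu]. The weak* topology on the dual is the
   one of pointwise convergence. *)
Definition functional (R : realType) (K : ptopologicalType)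
    (mu : radon_probability R K) : {ptws continuousType K R -> R} :=
  fun f => (\int[val mu]_x f x)%R.

(* P(K). A library measure also has (irrelevant) values on non-measurable sets;
   measures differing only there have the same functional, hence the same
   neighbourhoods, so that they do not affect the character. *)
Definition PK (R : realType) (K : ptopologicalType) : topologicalType :=
  initial_topology (@functional R K).

Definition strongly_determined (R : realType) (K : ptopologicalType)
    (mu : set (borel K) -> \bar R) (kappa : Type) : Prop :=
  exists f : K -> {ptws kappa -> set_type (`[0%R, 1%R]%classic : set R)},
    continuous f /\
    forall F : set K, compact F -> mu F = mu (f @^-1` (f @` F)).

(* sd(mu) = kappa *)
Definition is_sd (R : realType) (K : ptopologicalType)
    (mu : set (borel K) -> \bar R) (kappa : Type) : Prop :=
  least_infinite_cardinal (strongly_determined mu) kappa.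

(* Main.v *)
(* For an infinite cardinal kappa, mu has a local base of size at most kappa iff
   mu is strongly kappa-determined; hence both least cardinals exist and agree.

   If a continuous f with kappa coordinates determines mu, consider the kappa
   many functions h obtained from the coordinates by rational affine maps,
   truncation to [0, 1], products and complements t |-> 1 - t. For F closed,
   mu F = mu (f^-1 (f F)), and some h is 1 on F and has mu-integral close to
   mu F. If nu nearly agrees with mu on h, then nu F <= mu F + d. Slicing a
   function g into its superlevel sets gives
   \int g dnu <= \int g dmu + d, and the same for 1 - g.

   Conversely, let each member of a local base of size kappa contain the
   neighbourhood given by finitely many functions, and let f have all of these
   functions as coordinates. If E = f^-1 (f F), collapse K onto finitely many
   points by a Borel map that nearly preserves finitely many coordinates and
   sends E into F. The image measures nu converge to mu and satisfy
   nu F >= mu E. Testing against a Urysohn function that is 1 on F and has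
   mu-integral close to mu F gives mu E <= mu F. *)
Require Import Defs.
From HB Require Import structures.
From mathcomp Require Import all_boot all_order all_algebra.
From mathcomp Require Import all_classical all_reals all_analysis.
From mathcomp Require Import measurable_realfun ring lra.
Import numFieldNormedType.Exports.

Import Order.TTheory GRing.Theory Num.Theory.

Local Open Scope classical_set_scope.
Local Open Scope ring_scope.

(** * Cardinals *)

Lemma card_le_setTP (A B : Type) :
  ([set: A] #<= [set: B])%card <-> exists f : A -> B, injective f.
Proof.
split=> [/card_leP[f]|[f finj]].
  exists (fun a => val (f (SigSub (mem_set (I : setT a))))).
  by move=> a a' /val_inj /(inj (in_setT _) (in_setT _)) [].
have /injfunPex[g] : exists2 f : A -> B, set_fun setT setT f & set_inj setT f.
  by exists f => // x y _ _; exact: finj.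
exact: inj_card_le g.
Qed.

(* Hoenig's argument: a maximal set of choice functions on which all the
   projections are injective has a surjective projection. *)
Lemma exists_least_type (I : Type) (A : I -> Type) (i0 : I) :
  exists i, forall j, exists f : A i -> A j, injective f.
Proof.
pose P (M : set (forall i, A i)) :=
  forall i x y, M x -> M y -> x i = y i -> x = y.
have [F FP Ftot|M [PM Mmax]] := @Zorn_bigcup _ P.
  move=> i x y [X FX Xx] [Y FY Yy].
  have [XY|YX] := Ftot _ _ FX FY.
    by apply: (FP _ FY) => //; exact: XY.
  by apply: (FP _ FX) => //; exact: YX.
have [i iP] : exists i, forall a : A i, exists2 x, M x & x i = a.
  apply: contrapT => /forallNP nM.
  have /(_ _)/cid aP : forall i, exists a : A i, ~ exists2 x, M x & x i = a.
    by move=> i; apply/existsNP/nM.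
  (* If no projection is onto, [a] avoids at every index the values taken by [M]. Adding it to [M]
     then keeps all projections injective, against maximality; its value at [i0] shows that it is
     new. *)
  pose a i := sval (aP i);
  have naP i := svalP (aP i) : ~ exists2 x, M x & x i = a i.
  have Ma : ~ M a by move=> Ma; apply: (naP i0); exists a.
  apply: (Mmax (M `|` [set a])).
    split; first by left.
    by move=> /(_ a); apply: contra_not Ma => /(_ (or_intror erefl)).
  move=> i x y [Mx|->] [My|->] // xy.
  - exact: PM xy.
  - by case: (naP i); exists x.
  - by case: (naP i); exists y.
have {}iP (a : A i) : exists x, M x /\ x i = a by have [x] := iP a; exists x.
have [g gP] := choice iP.
exists i => j; exists (fun a => g a j) => a a' aa'.
have [Ma ga] := gP a; have [Ma' ga'] := gP a'.
by rewrite -ga -ga' (PM _ _ _ Ma Ma' aa').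
Qed.

Lemma card_le_setT_total (A B : Type) :
  (exists f : A -> B, injective f) \/ (exists f : B -> A, injective f).
Proof.
have [[] cP] := exists_least_type bool (fun b => if b then A else B) true.
- by left; exact: (cP false).
- by right; exact: (cP true).
Qed.

(** A least one among the infinite subsets of [W] satisfying [P] is least among all types: by
    comparability, either [W] embeds into [L], or [L] has a copy inside [W], which is one of the
    competitors. *)
Lemma exists_least_infinite_cardinal (P : Type -> Prop) (W : Type) :
  (forall A B : Type, (exists f : A -> B, injective f) -> P A -> P B) ->
  infinite_set [set: W] -> P W -> exists kappa, least_infinite_cardinal P kappa.
Proof.
move=> P_up infW PW.
have infinite_emb (A B : Type) : (exists f : A -> B, injective f) ->
    infinite_set [set: A] -> infinite_set [set: B].
  by move=> /card_le_setTP AB; apply: contra_not; exact: card_le_finite AB.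
pose I := {S : set W | infinite_set [set: set_type S] /\ P (set_type S)}.
have sub_range (A : Type) (f : A -> W) : injective f ->
    (exists g : A -> set_type (range f), injective g) /\
    (exists g : set_type (range f) -> A, injective g).
  move=> finj; split.
    exists (fun a => SigSub (mem_set (imageT f a))).
    by move=> a a' [/finj].
  have rP (s : set_type (range f)) : exists a, f a = val s.
    by have /set_mem[a _ <-] := valP s; exists a.
  have [g gP] := choice rP.
  by exists g => s s' ss'; apply: val_inj; rewrite -gP -gP ss'.
have mkI (A : Type) (f : A -> W) : injective f -> infinite_set [set: A] ->
    P A -> exists S : I, exists g : set_type (sval S) -> A, injective g.
  move=> /sub_range[Af fA] infA PA.
  have SP : infinite_set [set: set_type (range f)] /\ P (set_type (range f)).
    by split; [exact: infinite_emb Af infA|exact: P_up Af PA].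
  by exists (exist (fun S => infinite_set [set: set_type S] /\ P (set_type S))
    (range f) SP).
have [S0 _] := mkI W id (@inj_id _) infW PW.
have [S SP] := exists_least_type I (fun S => set_type (sval S)) S0.
have [infS PS] := svalP S.
exists (set_type (sval S)); split=> // L infL PL; apply/card_le_setTP.
have [[f finj]|[f finj]] := card_le_setT_total W L.
  exists (f \o val); exact: inj_comp val_inj.
have [S' [g ginj]] := mkI _ _ finj infL PL.
have [h hinj] := SP S'.
exists (g \o h); exact: inj_comp ginj hinj.
Qed.

(** * Squares and finite sequences over an infinite set *)

Section infinite_square.
Context (T : Type).

Let is_pairing (A : set T) (g : T -> T -> T) :=
  (forall x y, A x -> A y -> A (g x y)) /\
  (forall x y x' y', A x -> A y -> A x' -> A y' ->
     g x y = g x' y' -> x = x' /\ y = y').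

(** The two distinct points of the domain serve later as bits, recording on which side of a
    partition a point lies. *)
Let pairing := {p : set T * (T -> T -> T) |
  is_pairing p.1 p.2 /\ exists c : bool -> T, injective c /\ forall b, p.1 (c b)}.

Let extends (p q : pairing) := `[< (sval p).1 `<=` (sval q).1 /\
  forall x y, (sval p).1 x -> (sval p).1 y -> (sval p).2 x y = (sval q).2 x y >].

(** A countable subset carries a pairing, transported from the encoding of pairs of natural
    numbers. *)
Let exists_pairing : infinite_set [set: T] -> $|pairing|.
Proof.
move=> /infiniteP/card_le_setTP[e einj].
have rP (x : T) : exists n, range e x -> e n = x.
  have [[n _ <-]|nx] := pselect (range e x); first by exists n.
  by exists 0%N => /nx.
have [r {}rP] := choice rP.
apply: squash.
exists (range e, fun x y => e (pickle (r x, r y))); split=> /=.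
  split; first by move=> x y _ _; exact: imageT.
  move=> x y x' y' Ax Ay Ax' Ay' /einj /(pcan_inj pickleK)[].
  by move=> /(congr1 e); rewrite !rP// => -> /(congr1 e); rewrite !rP.
exists (fun b : bool => e b); split; last by move=> b; exact: imageT.
by move=> [] [] // /einj.
Qed.

(** Members of a chain agree where both are defined, so they glue to one operation on the union of
    the domains. Injectivity involves four points, which lie in one common domain. The empty chain
    is bounded by [p0]. *)
Let chain_bound (p0 : pairing) (C : set pairing) : total_on C extends ->
  exists t, forall s, C s -> extends s t.
Proof.
move=> Ctot.
have [[p1 Cp1]|/forallNP C0] := pselect (exists p, C p); last first.
  by exists p0 => s /C0.
pose A := \bigcup_(p in C) (sval p).1.
have gP (xy : T * T) : exists z, forall p, C p -> (sval p).1 xy.1 ->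
    (sval p).1 xy.2 -> (sval p).2 xy.1 xy.2 = z.
  have [[p [Cp px py]]|nC] := pselect (exists p, [/\ C p, (sval p).1 xy.1 &
      (sval p).1 xy.2]); last first.
    by exists xy.1 => p Cp px py; case: nC; exists p.
  exists ((sval p).2 xy.1 xy.2) => q Cq qx qy.
  have [/asboolP[_ pq]|/asboolP[_ qp]] := Ctot _ _ Cp Cq.
    by rewrite pq.
  by rewrite qp.
have {gP}[g gP] := choice gP.
have common x y : A x -> A y -> exists p, [/\ C p, (sval p).1 x & (sval p).1 y].
  move=> [p Cp px] [q Cq qy].
  have [/asboolP[pq _]|/asboolP[qp _]] := Ctot _ _ Cp Cq.
    by exists q; split=> //; exact: pq.
  by exists p; split=> //; exact: qp.
have AgP : is_pairing A (fun x y => g (x, y)).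
  split=> [x y Ax Ay|x y x' y' Ax Ay Ax' Ay'].
    have [p [Cp px py]] := common _ _ Ax Ay.
    have [[pclosed _] _] := svalP p.
    by rewrite -(gP (x, y) p)//; exists p => //; exact: pclosed.
  have [p [Cp px py]] := common _ _ Ax Ay.
  have [q [Cq qx qy]] := common _ _ Ax' Ay'.
  have [t [Ct tx ty tx' ty']] : exists t, [/\ C t, (sval t).1 x, (sval t).1 y,
      (sval t).1 x' & (sval t).1 y'].
    have [/asboolP[pq _]|/asboolP[qp _]] := Ctot _ _ Cp Cq.
      by exists q; split=> //; exact: pq.
    by exists p; split=> //; exact: qp.
  rewrite -(gP (x, y) t)// -(gP (x', y') t)//.
  by have [[_ tinj] _] := svalP t; exact: tinj.
have cA : exists c : bool -> T, injective c /\ forall b, A (c b).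
  have [_ [c [cinj cp1]]] := svalP p1.
  by exists c; split=> // b; exists p1.
exists (exist _ (A, fun x y => g (x, y)) (conj AgP cA)) => s Cs.
apply/asboolP; split=> /= [x sx|x y sx sy]; first by exists s.
by rewrite -(gP (x, y) s).
Qed.

(* A maximal pairing lives on some A. If A embeds into its complement, the pairing
   extends to A and a copy of A; otherwise T embeds into A * A, hence into A. *)
Lemma infinite_square : infinite_set [set: T] ->
  exists f : T * T -> T, injective f.
Proof.
move=> /exists_pairing/unsquash p0.
have [t|q p r|C|p pmax] := @ZL_preorder pairing p0 extends.
- by apply/asboolP; split.
- move=> /asboolP[qp qpE] /asboolP[pr prE]; apply/asboolP; split.
    exact: subset_trans pr.
  by move=> x y qx qy; rewrite qpE// prE//; exact: qp.
- exact: chain_bound.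
have [[pclosed pinj] [c [cinj cA]]] := svalP p.
move: (pclosed) (pinj) (cA).
set A := (sval p).1; set g := (sval p).2 => {}pclosed {}pinj {}cA.
have extend (B : Type) (b : set_type A -> B) : injective b -> forall dflt : T -> B,
    exists b' : T -> B, (forall x, A x -> exists y, b' x = b y) /\
      forall x y, A x -> A y -> b' x = b' y -> x = y.
  move=> binj dflt.
  exists (fun x => if pselect (A x) is left Ax then b (SigSub (mem_set Ax))
    else dflt x); split=> [x Ax|x y Ax Ay]; case: pselect => // Ax'.
    by exists (SigSub (mem_set Ax')).
  by case: pselect => // Ay' /binj [].
have [[b binj]|[b binj]] := card_le_setT_total (set_type A) (set_type (~` A)).
- exfalso.
  have [b' [b'A b'inj]] := extend _ (val \o b) (inj_comp val_inj binj) id.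
  pose B := b' @` A.
  have BA x : B x -> ~ A x.
    by move=> [y /b'A[z /= -> <-]]; exact: (set_mem (valP (b z))).
  have rP (x : T) : exists y, (A x -> y = x) /\ (B x -> A y /\ b' y = x).
    have [Ax|nAx] := pselect (A x); first by exists x; split=> // /BA.
    have [[y Ay yx]|nBx] := pselect (B x); last by exists x.
    by exists y.
  have [r {}rP] := choice rP.
  have rA x : (A `|` B) x -> A (r x).
    by move=> [Ax|Bx]; [rewrite (rP x).1|case: ((rP x).2 Bx)].
  have rinj x y : (A `|` B) x -> (A `|` B) y -> `[< A x >] = `[< A y >] ->
      r x = r y -> x = y.
    move=> ABx ABy; have [Ax|nAx] := pselect (A x).
      by rewrite (asboolT Ax) => /esym/asboolP Ay; rewrite (rP x).1// (rP y).1.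
    rewrite (asboolF nAx) => /esym/asboolPn nAy rxy.
    have [[//|Bx] [//|By]] := (ABx, ABy).
    by have [_ <-] := (rP x).2 Bx; have [_ <-] := (rP y).2 By; rewrite rxy.
  (* Here [r] is the identity on [A] and inverts [b'] on [B]. With the bit for the side, [code]
     embeds the union of [A] and [B] into [A]. *)
  pose code x := g (c `[< A x >]) (r x).
  have codeA x : (A `|` B) x -> A (code x).
    by move=> ABx; apply: pclosed => //; exact: rA.
  have codeinj x y : (A `|` B) x -> (A `|` B) y -> code x = code y -> x = y.
    move=> ABx ABy /pinj[]//; do ?exact: rA.
    by move=> /cinj; exact: rinj.
  (* Pairs from [A] keep their old value in [A]; all others get a value in [B]. As [A] and [B] are
     disjoint, the two kinds cannot collide. *)
  pose h x y := if pselect (A x /\ A y) then g x y else b' (g (code x) (code y)).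
  have hB x y : (A `|` B) x -> (A `|` B) y -> B (b' (g (code x) (code y))).
    move=> ABx ABy; exists (g (code x) (code y)) => //.
    by apply: pclosed; exact: codeA.
  have hpair : is_pairing (A `|` B) h.
    split=> [x y ABx ABy|x y x' y' ABx ABy ABx' ABy']; rewrite /h.
      case: (pselect (A x /\ A y)) => [[Ax Ay]|nA]; first by left; exact: pclosed.
      by right; exact: hB.
    case: (pselect (A x /\ A y)) => [[Ax Ay]|nA];
      case: (pselect (A x' /\ A y')) => [[Ax' Ay']|nA'].
    - exact: pinj.
    - by move=> /= E; have := BA _ (hB _ _ ABx' ABy'); rewrite -E; case; exact: pclosed.
    - by move=> /= E; have := BA _ (hB _ _ ABx ABy); rewrite E; case; exact: pclosed.
    - move=> /= /b'inj E.
      have [|xx' yy'] := pinj _ _ _ _ (codeA _ ABx) (codeA _ ABy) (codeA _ ABx')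
        (codeA _ ABy'); first by apply: E; apply: pclosed; exact: codeA.
      by split; exact: codeinj.
  have hc : exists c : bool -> T, injective c /\ forall b, (A `|` B) (c b).
    by exists c; split=> // d; left.
  have pq : extends p (exist _ (A `|` B, h) (conj hpair hc)).
    apply/asboolP; split=> /= [|x y Ax Ay]; first exact: subsetUl.
    by rewrite /h; case: (pselect (A x /\ A y)) => // -[].
  (* Maximality would put [B] inside [A], yet [B] is disjoint from [A] and contains
     [b' (c true)]. *)
  have /asboolP[] := pmax _ pq.
  move=> /= ABA _; have cB : B (b' (c true)) by exists (c true).
  by apply: (BA _ cB); apply: ABA; right.
(* Here the complement of [A] embeds into [A]: [h] fixes [A] and applies [b] elsewhere, and a bit
   tells the two apart. *)
- have hP (x : T) : exists y, A y /\ ((A x -> y = x) /\ forall nAx : ~ A x,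
      y = val (b (SigSub (mem_set (nAx : (~` A) x))))).
    have [Ax|nAx] := pselect (A x); first by exists x.
    exists (val (b (SigSub (mem_set (nAx : (~` A) x))))); split.
      exact: (set_mem (valP (b _))).
    by split=> // nAx'; congr (val (b _)); exact: val_inj.
  have [h {}hP] := choice hP.
  have hinj x y : `[< A x >] = `[< A y >] -> h x = h y -> x = y.
    have [_ [hx hx']] := hP x; have [_ [hy hy']] := hP y.
    have [Ax|nAx] := pselect (A x).
      by rewrite (asboolT Ax) => /esym/asboolP Ay; rewrite hx// hy.
    rewrite (asboolF nAx) => /esym/asboolPn nAy.
    by rewrite (hx' nAx) (hy' nAy) => /val_inj/binj[].
  pose code x := g (c `[< A x >]) (h x).
  have hA x : A (h x) by have [] := hP x.
  have codeA x : A (code x) by exact: pclosed.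
  have codeinj : injective code by move=> x y /pinj[]// /cinj; exact: hinj.
  exists (fun xy => g (code xy.1) (code xy.2)) => -[x y] [x' y'] /pinj[]//=.
  by move=> /codeinj -> /codeinj ->.
Qed.
End infinite_square.

(** A sequence is folded into nested pairs. Its length is stored as well, since the end marker [e 0]
    may itself be the code of a pair. *)
Lemma infinite_seq (T : Type) : infinite_set [set: T] ->
  exists f : seq T -> T, injective f.
Proof.
move=> infT; have [p pinj] := infinite_square T infT.
have /infiniteP/card_le_setTP[e einj] := infT.
pose enc := foldr (fun x acc => p (x, acc)) (e 0%N).
exists (fun s => p (e (size s), enc s)) => s t /pinj[/einj].
elim: s t => [|x s IH] [|y t]//= [st] /pinj[-> /(IH _ st)].
by move=> ->.
Qed.

Lemma inj_pair (A B A' B' : Type) (f : A -> A') (g : B -> B') :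
  injective f -> injective g -> injective (fun p : A * B => (f p.1, g p.2)).
Proof. by move=> finj ginj [a b] [a' b'] [/finj -> /ginj ->]. Qed.

Lemma map_injective (A B : Type) (f : A -> B) : injective f ->
  injective (map f).
Proof. by move=> finj; elim=> [|a s IH] [|b t]//= [/finj -> /IH ->]. Qed.

(** * Integrals over a compact space *)

Section integral_on_compact.
Context (R : realType) (K : ptopologicalType).
Implicit Types (m : probability (borel K) R) (f g : K -> R).

Lemma open_borel (U : set K) : open U -> measurable (U : set (borel K)).
Proof. by move=> oU; exact: sub_sigma_algebra. Qed.

Lemma closed_borel (F : set K) : closed F -> measurable (F : set (borel K)).
Proof.
by move=> /closed_openC/open_borel/measurableC; rewrite setCK.
Qed.

Lemma continuous_borel f : continuous f ->
  measurable_fun setT (f : borel K -> R).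
Proof.
move=> cf; apply: (measurability _ (RGenOInfty.measurableE R)) => _ [_ [x ->] <-].
rewrite setTI; apply: open_borel; apply: open_comp => //; exact: rray_open.
Qed.

Hypothesis compactK : compact [set: K].

Lemma continuous_bounded f : continuous f ->
  exists2 M : R, 0 < M & forall x, `|f x| <= M.
Proof.
move=> cf; have /compact_bounded[M [_ fM]] : compact (f @` setT).
  by apply: continuous_compact => //; exact: continuous_subspaceT.
exists (`|M| + 1); first by rewrite ltr_wpDl.
by move=> x; apply: fM; [rewrite ltr_pwDr// ler_norm|exists x].
Qed.

Lemma bounded_integrable m f M : measurable_fun setT (f : borel K -> R) ->
  (forall x, `|f x| <= M) -> m.-integrable setT (EFin \o f).
Proof.
move=> mf fM; apply: measurable_bounded_integrable => //.
  by rewrite (le_lt_trans (probability_le1 _ _))// ltry.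
exists M; split; first exact: num_real.
by move=> N MN x _ /=; rewrite (le_trans (fM x))// ltW.
Qed.

Lemma continuous_integrable m f : continuous f ->
  m.-integrable setT (EFin \o f).
Proof.
move=> cf; have [M _ fM] := continuous_bounded f cf.
by apply: bounded_integrable fM; exact: continuous_borel.
Qed.

Lemma indic_integrable m (A : set (borel K)) : measurable A ->
  m.-integrable setT (EFin \o (\1_A : borel K -> R)).
Proof.
move=> mA; apply: (bounded_integrable _ _ 1) => [|x]; first exact: measurable_indic.
by rewrite indicE; case: (_ \in _); rewrite ?normr1 ?normr0.
Qed.

Lemma EFin_integrableD m f g : m.-integrable setT (EFin \o f) ->
  m.-integrable setT (EFin \o g) ->
  m.-integrable setT (EFin \o (fun x => f x + g x)).
Proof. by move=> mf mg; have := integrableD measurableT mf mg. Qed.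

Lemma Rintegral_indicT m (A : set (borel K)) : measurable A ->
  \int[m]_x (\1_A x : R) = fine (m A).
Proof. by move=> mA; rewrite /Rintegral integral_indic// setIT. Qed.

Lemma Rintegral_cstT m (c : R) : \int[m]_x c = c.
Proof.
by rewrite Rintegral_cst//= (probability_setT m) mulr1.
Qed.

Lemma fine_probability_setC m (A : set (borel K)) : measurable A ->
  fine (m (~` A)) = 1 - fine (m A).
Proof.
by move=> mA; rewrite (probability_setC m)// fineB// fin_num_measure.
Qed.

Lemma Rintegral_ge_closed m f (F : set K) : continuous f ->
  closed F -> (forall x, 0 <= f x) -> (forall x, F x -> 1 <= f x) ->
  fine (m F) <= \int[m]_x f x.
Proof.
move=> cf /closed_borel mF f0 f1; rewrite -Rintegral_indicT//.
apply: le_Rintegral => //; [exact: indic_integrable|exact: continuous_integrable|].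
by move=> x _; rewrite indicE; case: (boolP (_ \in _)) => [/set_mem/f1|].
Qed.

(** The indicator of the complement of [C] dominates [f]. Together with [Rintegral_ge_closed], this
    turns closeness of integrals of a separating function into estimates for measures of closed
    sets. *)
Lemma Rintegral_le_closed m f (C : set K) : continuous f ->
  closed C -> (forall x, f x <= 1) -> (forall x, C x -> f x <= 0) ->
  \int[m]_x f x <= 1 - fine (m C).
Proof.
move=> cf cC f1 f0; have mC := closed_borel _ cC.
rewrite -fine_probability_setC// -Rintegral_indicT//; last exact: measurableC.
apply: le_Rintegral => //; first exact: continuous_integrable.
  by apply: indic_integrable; exact: measurableC.
move=> x _; rewrite indicE in_setC.
by case: (boolP (x \in C)) => [/set_mem/f0|].
Qed.

(** The sum counts the integers from 1 to [n] that are at most [t]; since [t <= n], this is the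
    integer part of [t]. *)
Lemma layer_cake_bounds (t : R) (n : nat) : 0 <= t -> t <= n%:R ->
  let s := \sum_(k < n) ((k.+1%:R <= t)%R%:R : R) in s <= t /\ t <= s + 1.
Proof.
move=> t0 tn s; pose j := Num.truncn t.
have jn : (j <= n)%N.
  rewrite -(ler_nat R) (le_trans _ tn)//.
  by have /andP[] := truncn_itv t0.
have -> : s = j%:R.
  rewrite /s (eq_bigr (fun k : 'I_n => ((k < j)%N)%:R)); last first.
    by move=> k _; rewrite truncn_gt_nat.
  rewrite -natr_sum; congr (_%:R).
  rewrite (eq_bigr (fun k : 'I_n => if (k < j)%N then 1%N else 0%N)); last first.
    by move=> k _; case: ifP.
  by rewrite -big_mkcond -(big_ord_widen n (fun=> 1%N) jn) sum1_card card_ord.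
have /andP[j1 j2] := truncn_itv t0.
by split=> //; rewrite natr1 ltW.
Qed.
End integral_on_compact.

(** * Comparison of integrals through superlevel sets *)

Section layer_cake.
Context (R : realType) (K : ptopologicalType).
Hypothesis compactK : compact [set: K].
Implicit Types (m : probability (borel K) R) (g : K -> R).

Lemma Rintegral_sum_indic m (F : nat -> set (borel K)) (n : nat) :
  (forall k, measurable (F k)) ->
  m.-integrable setT (EFin \o (fun x => \sum_(k < n) (\1_(F k) x : R))) /\
  \int[m]_x (\sum_(k < n) (\1_(F k) x : R)) = \sum_(k < n) fine (m (F k)).
Proof.
move=> mF; elim: n => [|n [IHi IHe]].
  split; last first.
    by under eq_Rintegral do rewrite big_ord0; rewrite big_ord0 Rintegral_cstT.
  apply: (bounded_integrable _ _ _ _ 0) => [|x].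
    by apply: measurable_sum => k; exact: measurable_indic.
  by rewrite big_ord0 normr0.
have E : (fun x : borel K => \sum_(k < n.+1) (\1_(F k) x : R)) =
    (fun x => \sum_(k < n) (\1_(F k) x : R) + \1_(F n) x).
  by apply/funext => x; rewrite big_ord_recr.
rewrite E; split; last first.
  rewrite RintegralD// ?IHe ?Rintegral_indicT// ?big_ord_recr//.
  exact: indic_integrable.
by apply: EFin_integrableD => //; exact: indic_integrable.
Qed.

(** Let [s] be the sum of the indicators of the [n] slices of [n * g]. Then [n * g <= s + 1] is
    integrated against [m'], and [s <= n * g] against [m]. Each slice costs [d], and division by [n]
    leaves the error [d + 1/n]. *)
Lemma Rintegral_le_of_superlevel m m' g (n : nat) (d : R) : continuous g ->
  (forall x, 0 <= g x <= 1) -> (0 < n)%N ->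
  (forall k, (k < n)%N -> let F := [set x | k.+1%:R <= n%:R * g x] in
    fine (m' F) <= fine (m F) + d) ->
  \int[m']_x g x <= \int[m]_x g x + d + n%:R^-1.
Proof.
move=> cg g01 n0 mF.
pose F (k : nat) : set (borel K) := [set x | k.+1%:R <= n%:R * g x].
have cng : continuous (fun x => n%:R * g x).
  by move=> x; apply: cvgM; [exact: cvg_cst|exact: cg].
have mFk k : measurable (F k).
  apply: closed_borel.
  have -> : F k = (fun x => n%:R * g x) @^-1` [set r | k.+1%:R <= r] by [].
  by apply: closed_comp.
have ng x : 0 <= n%:R * g x <= n%:R.
  by have /andP[g0 g1] := g01 x; rewrite mulr_ge0// ler_piMr.
have Fx x : \sum_(k < n) (\1_(F k) x : R) =
    \sum_(k < n) ((k.+1%:R <= n%:R * g x)%R%:R : R).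
  apply: eq_bigr => k _; rewrite indicE; congr (nat_of_bool _)%:R.
  by apply/idP/idP => [/set_mem|/mem_set].
have [im' em'] := Rintegral_sum_indic m' F n mFk.
have [im em] := Rintegral_sum_indic m F n mFk.
have ic (mm : probability (borel K) R) := continuous_integrable _ _ compactK mm _ cng.
have nE (mm : probability (borel K) R) :
    \int[mm]_x (n%:R * g x) = n%:R * \int[mm]_x g x.
  by rewrite RintegralZl//; exact: continuous_integrable.
have up : n%:R * \int[m']_x g x <= \sum_(k < n) fine (m' (F k)) + 1.
  rewrite -nE -em' -[X in _ + X](Rintegral_cstT _ _ m') -RintegralD//; last first.
    by apply: continuous_integrable => // x; exact: cvg_cst.
  apply: le_Rintegral => //.
    exact: ic.
    apply: (EFin_integrableD _ _ _ _ (fun=> 1)) => //.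
    by apply: continuous_integrable => // x; exact: cvg_cst.
  move=> x _; rewrite Fx; have /andP[g0 g1] := ng x.
  by have [] := layer_cake_bounds _ _ _ g0 g1.
have lo : \sum_(k < n) fine (m (F k)) <= n%:R * \int[m]_x g x.
  rewrite -nE -em; apply: le_Rintegral => //; first exact: ic.
  move=> x _; rewrite Fx; have /andP[g0 g1] := ng x.
  by have [] := layer_cake_bounds _ _ _ g0 g1.
have sumd : \sum_(k < n) fine (m' (F k)) <= \sum_(k < n) fine (m (F k)) + n%:R * d.
  rewrite mulr_natl -[X in _ *+ X]card_ord -sumr_const -big_split/=.
  by apply: ler_sum => k _; exact: mF.
have n0' : 0 < n%:R :> R by rewrite ltr0n.
rewrite -(ler_pM2l n0') !mulrDr divff ?gt_eqF//; lra.
Qed.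
End layer_cake.

(** * The weak* topology and its basic neighbourhoods *)

Section weak_star.
Context (R : realType) (K : ptopologicalType).

Definition mean (nu : PK R K) (f : K -> R) : R := \int[val nu]_x f x.

Lemma mean_continuous (f : K -> R) : continuous f ->
  continuous (fun nu : PK R K => mean nu f).
Proof.
move=> cf nu.
pose cF : continuousType K R := mkcts cf.
have c1 := @initial_continuous _ _ (@functional R K) nu.
have c2 := @proj_continuous _ (fun _ : continuousType K R => R) cF (functional nu).
exact: cvg_comp c1 c2.
Qed.

(** Open sets of [PK] are preimages from the space of functionals, whose topology is a supremum over
    single functions; hence each function can be tested alone. *)
Lemma cvg_PK (F : set_system (PK R K)) (mu : PK R K) : Filter F ->
  (forall (f : continuousType K R) (e : R), 0 < e ->
    F [set nu | `|mean nu f - mean mu f| < e]) -> F --> mu.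
Proof.
move=> FF Fmean U.
rewrite nbhsE => -[V [[W oW <-] Wmu] VU].
apply: filterS VU _.
have cF : (@functional R K) @ F --> (functional mu : {ptws continuousType K R -> R}).
  apply/cvg_sup => f V'.
  rewrite nbhsE => -[V'' [[W' oW' <-] W'mu] V''V'].
  suff FW : F ((fun nu => mean nu f) @^-1` W').
    exact: (@filterS _ F _ _ ((@functional R K) @^-1` V')
      (fun nu => V''V' (functional nu)) FW).
  have /nbhs_ballP[e e0 eW'] : nbhs (functional mu f) W' by exact: open_nbhs_nbhs.
  have := Fmean f e e0; apply: filterS => nu nue.
  by apply: eW'; rewrite /ball/= distrC.
by apply: cF; exact: open_nbhs_nbhs.
Qed.

(** Finite lists and tolerances [1/(n+1)] make the index a type whose cardinality can be bounded by
    that of an infinite [A]. *)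
Definition basic_nbhs {A : Type} (u : A -> K -> R) (mu : PK R K)
    (p : seq A * nat) : set (PK R K) :=
  [set nu | all (fun a => `|mean nu (u a) - mean mu (u a)| < p.2.+1%:R^-1) p.1].

Lemma basic_nbhs_open (A : Type) (u : A -> K -> R) mu p :
  (forall a, continuous (u a)) -> open_nbhs mu (basic_nbhs u mu p).
Proof.
move=> cu; split; last first.
  rewrite /basic_nbhs/=; elim: p.1 => //= a s ->.
  by rewrite subrr normr0 invr_gt0 ltr0n.
case: p => s n; rewrite /basic_nbhs/=; elim: s => [|a s IH] /=.
  have -> : [set _ | true] = [set: PK R K] by rewrite predeqE.
  exact: openT.
have -> : [set nu | (`|mean nu (u a) - mean mu (u a)| < n.+1%:R^-1) &&
   all (fun a => `|mean nu (u a) - mean mu (u a)| < n.+1%:R^-1) s] =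
  ((fun nu => mean nu (u a)) @^-1` ball (mean mu (u a)) n.+1%:R^-1) `&`
  [set nu | all (fun a => `|mean nu (u a) - mean mu (u a)| < n.+1%:R^-1) s].
  apply/seteqP; split=> nu /=; rewrite /ball/= distrC; first by move/andP.
  by move=> ?; exact/andP.
apply: openI => //; apply: open_comp; last exact: ball_open.
by move=> x _; exact: mean_continuous.
Qed.

Lemma basic_nbhs_filter (A : Type) (u : A -> K -> R) mu :
  Filter (filter_from setT (basic_nbhs u mu)).
Proof.
apply: filter_from_filter; first by exists ([::], 0%N).
move=> [s n] [t k] _ _; exists (s ++ t, maxn n k) => // nu.
rewrite /basic_nbhs/= all_cat => /andP[sP tP]; split.
  apply: sub_all sP => a /lt_le_trans; apply.
  by rewrite lef_pV2 ?posrE ?ltr0n// ler_nat ltnS leq_maxl.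
apply: sub_all tP => a /lt_le_trans; apply.
by rewrite lef_pV2 ?posrE ?ltr0n// ler_nat ltnS leq_maxr.
Qed.
End weak_star.
Arguments mean {R K}.
Arguments basic_nbhs {R K A}.

(** * Functions generated by a family of coordinates *)

(** Compactness in list form: the finitely many selected witnesses keep the property [Q]. Clauses,
    terms and the collapsing map are all built from such lists. *)
Lemma compact_subcover_seq (K : ptopologicalType) (T : Type) (Q : T -> Prop)
    (C : set K) (V : T -> set K) : compact C ->
  (forall y, C y -> exists a, Q a /\ nbhs y (V a)) ->
  exists s : seq T, all (fun a => `[< Q a >]) s /\
    forall y, C y -> has (fun a => `[< V a y >]) s.
Proof.
move=> cC CV; have Ccov : cover_compact C by rewrite -compact_cover.
(* For empty [C] the type [T] might be empty too; otherwise a point of [C] supplies the default [a0]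
   for the choice. *)
have [[y0 Cy0]|C0] := pselect (C !=set0); last first.
  by exists [::]; split=> // y Cy; case: C0; exists y.
have [a0 _] := CV _ Cy0.
have aP y : exists a, C y -> Q a /\ nbhs y (V a).
  by have [/CV[a aP]|nC] := pselect (C y); [exists a|exists a0].
have [a {}aP] := choice aP.
have [|y Cy|D DC Dcov] := Ccov K C (fun y => (V (a y))°).
- by move=> y _; exact: open_interior.
- by exists y => //; have [_] := aP y Cy.
exists [seq a y | y <- finmap.enum_fset D]; split.
  rewrite all_map; apply/allP => y /DC/set_mem/aP[Qa _]; exact/asboolP.
move=> y /Dcov[z zD /interior_subset Vz].
by rewrite has_map; apply/hasP; exists z => //; exact/asboolP.
Qed.

Section lattice_terms.
Context (R : realType) (K : ptopologicalType) (kappa : Type).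
Context (u : kappa -> K -> R).
Local Notation atoms := (kappa * rat * rat)%type.

(** This is truncation to [[0, 1]], written with absolute values so that continuity follows from
    that of the norm. *)
Definition clamp (t : R) : R := (1 + `|t| - `|t - 1|) / 2.

Definition atom (a : atoms) (x : K) : R :=
  clamp (ratr a.1.2 * u a.1.1 x + ratr a.2).

Definition clause (s : seq atoms) (x : K) : R := \prod_(a <- s) atom a x.

(** Products act as conjunctions, and [1 - \prod (1 - _)] as a disjunction: a term is 1 where some
    clause is 1, and 0 where all clauses are 0. *)
Definition term (t : seq (seq atoms)) (x : K) : R :=
  1 - \prod_(s <- t) (1 - clause s x).

Lemma clamp0 t : t <= 0 -> clamp t = 0.
Proof.
by move=> t0; rewrite /clamp ler0_norm// ler0_norm; lra.
Qed.

Lemma clamp1 t : 1 <= t -> clamp t = 1.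
Proof.
by move=> t1; rewrite /clamp ger0_norm ?ger0_norm; lra.
Qed.

Lemma clamp_itv t : 0 <= clamp t <= 1.
Proof.
have [/clamp0 ->|t0] := leP t 0; first by lra.
have [/clamp1 ->|t1] := leP 1 t; first by lra.
by rewrite /clamp gtr0_norm// ltr0_norm; lra.
Qed.

Lemma clause_itv s x : 0 <= clause s x <= 1.
Proof.
apply/andP; split; last by apply: prodr_ile1 => a _; exact: clamp_itv.
apply: prodr_ge0 => a _.
by have /andP[] := clamp_itv (ratr a.1.2 * u a.1.1 x + ratr a.2).
Qed.

Lemma term_itv t x : 0 <= term t x <= 1.
Proof.
have : 0 <= \prod_(s <- t) (1 - clause s x) <= 1; last by rewrite /term; lra.
have cl s : 0 <= 1 - clause s x <= 1 by have := clause_itv s x; lra.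
by rewrite prodr_ile1// prodr_ge0// => s _; have /andP[] := cl s.
Qed.

Lemma term_eq t x y : (forall i, u i x = u i y) -> term t x = term t y.
Proof.
move=> uxy; congr (1 - _); apply: eq_bigr => s _; congr (1 - _).
by apply: eq_bigr => a _; rewrite /atom uxy.
Qed.

Hypothesis cu : forall i, continuous (u i).

Lemma continuous_prod (I : Type) (s : seq I) (f : I -> K -> R) :
  (forall i, continuous (f i)) -> continuous (fun x => \prod_(i <- s) f i x).
Proof.
move=> cf; elim: s => [|i s IH].
  by under eq_fun do rewrite big_nil; move=> x; exact: cvg_cst.
by under eq_fun do rewrite big_cons; move=> x; apply: cvgM; [exact: cf|exact: IH].
Qed.

Lemma atom_continuous a : continuous (atom a).
Proof.
have caff : continuous (fun z => ratr a.1.2 * u a.1.1 z + ratr a.2 : R).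
  move=> z; apply: cvgD; last exact: cvg_cst.
  by apply: cvgM; [exact: cvg_cst|exact: cu].
move=> x; apply: cvgM; last exact: cvg_cst.
apply: cvgB; last by apply: cvg_norm; apply: cvgB; [exact: caff|exact: cvg_cst].
by apply: cvgD; [exact: cvg_cst|apply: cvg_norm; exact: caff].
Qed.

Lemma term_continuous t : continuous (term t).
Proof.
move=> x; apply: cvgB; first exact: cvg_cst.
move: x; apply: continuous_prod => s x; apply: cvgB; first exact: cvg_cst.
by move: x; apply: continuous_prod => a; exact: atom_continuous.
Qed.

Lemma atom_separation i x y : u i x != u i y -> exists a,
  nbhs x [set z | atom a z = 1] /\ nbhs y [set z | atom a z = 0].
Proof.
move=> uxy.
have [p [q [pq1 pq0]]] : exists p q : rat,
    1 < ratr p * u i x + ratr q :> R /\ ratr p * u i y + ratr q < 0 :> R.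
  have rat_sep (s t : R) : s < t -> exists p q : rat,
      (0 < ratr p :> R) /\ ratr p * s + ratr q < 0 /\ 1 < ratr p * t + ratr q.
    (* With rationals [s < b < c < t], the affine map is [(r - b) / (c - b)]. *)
    move=> st; have [b /itvP bst] := rat_in_itvoo st.
    have [c /itvP cbt] : exists c : rat, ratr c \in `](ratr b : R), t[.
      by apply: rat_in_itvoo; rewrite bst.
    exists (c - b)^-1, (- b / (c - b)).
    have cb : 0 < ratr (c - b) :> R by rewrite rmorphB/= subr_gt0 cbt.
    rewrite rmorphM/= rmorphN/= !fmorphV/=; set d : R := ratr (c - b) in cb *.
    have dE : d = ratr c - ratr b by rewrite /d rmorphB.
    split; first by rewrite invr_gt0.
    rewrite [d^-1 * s]mulrC [d^-1 * t]mulrC -!mulrDl; split.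
      by rewrite pmulr_llt0 ?invr_gt0// subr_lt0 bst.
    by rewrite ltr_pdivlMr// mul1r dE ltrD2r cbt.
  have [xy|yx|xy] := ltgtP (u i x) (u i y); last by rewrite xy eqxx in uxy.
    (* The value at [x] is the smaller one, so the map is replaced by 1 minus it. *)
    have [p [q [p0 [h1 h2]]]] := rat_sep _ _ xy.
    exists (- p), (1 - q); rewrite rmorphN rmorphB/= rmorph1; lra.
  have [p [q [p0 [h1 h2]]]] := rat_sep _ _ yx.
  by exists p, q.
have caff : continuous (fun z => ratr p * u i z + ratr q : R).
  move=> z; apply: cvgD; last exact: cvg_cst.
  by apply: cvgM; [exact: cvg_cst|exact: cu].
exists (i, p, q); split.
  have : nbhs x ((fun z => ratr p * u i z + ratr q : R) @^-1` [set r | 1 < r]).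
    by apply: caff; apply: open_nbhs_nbhs; split => //; exact: open_gt.
  by apply: filterS => z /= h; rewrite /atom clamp1// ltW.
have : nbhs y ((fun z => ratr p * u i z + ratr q : R) @^-1` [set r | r < 0]).
  by apply: caff; apply: open_nbhs_nbhs; split => //; exact: open_lt.
by apply: filterS => z /= h; rewrite /atom clamp0// ltW.
Qed.

(** Each point of [C] has a neighbourhood where some atom vanishes while being 1 near [x]. The
    product of finitely many such atoms vanishes on [C] and is still 1 near [x]. *)
Lemma clause_separation x (C : set K) : compact C ->
  (forall y, C y -> exists i, u i x != u i y) -> exists s,
  (forall y, C y -> clause s y = 0) /\ nbhs x [set z | clause s z = 1].
Proof.
move=> cC xC.
have [y /xC[i /atom_separation[a aP]]|s [s1 s0]] := compact_subcover_seq _ _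
    (fun a => nbhs x [set z | atom a z = 1]) C
    (fun a => [set z | atom a z = 0]) cC.
  by exists a.
exists s; split=> [y /s0|].
  rewrite /clause; elim: s {s1 s0} => //= a s IH; rewrite big_cons.
  by move=> /orP[/asboolP -> |/IH ->]; rewrite ?mul0r ?mulr0.
rewrite /clause; elim: s s1 {s0} => [_|a s IH /=/andP[/asboolP a1 /IH s1]].
  by apply: nearW => z; rewrite /= big_nil.
by apply: filterS2 a1 s1 => z /= a1 s1; rewrite big_cons a1 s1 mulr1.
Qed.

(** Finitely many clauses vanishing on [C] suffice for every point of [F] to have one equal to 1.
    The values 1 and 0 are attained exactly, without any limit process. *)
Lemma term_separation (F C : set K) : compact F -> compact C ->
  (forall x y, F x -> C y -> exists i, u i x != u i y) -> exists t,
  (forall x, F x -> term t x = 1) /\ (forall y, C y -> term t y = 0).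
Proof.
move=> cF cC FC.
have [x Fx|t [t0 t1]] := compact_subcover_seq _ _
    (fun s => forall y, C y -> clause s y = 0) F
    (fun s => [set z | clause s z = 1]) cF.
  by apply: clause_separation => // y; exact: FC.
exists t; split=> [x /t1|y Cy]; rewrite /term.
  suff E : has (fun s => `[< clause s x = 1 >]) t ->
      \prod_(s <- t) (1 - clause s x) = 0 by move=> /E ->; rewrite subr0.
  elim: t {t0 t1} => //= s t IH; rewrite big_cons.
  by move=> /orP[/asboolP -> |/IH ->]; rewrite ?subrr ?mul0r ?mulr0.
suff -> : \prod_(s <- t) (1 - clause s y) = 1 by rewrite subrr.
elim: t t0 {t1} => [_|s t IH /=/andP[/asboolP s0 /IH t0]]; first by rewrite big_nil.
by rewrite big_cons t0 s0// subr0 mulr1.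
Qed.

(** This is the preimage of the image of [F] under the map with coordinates [u]. *)
Definition saturation (F : set K) : set K :=
  [set x | exists2 y, F y & forall i, u i x = u i y].

(** A point outside is separated from [F] by a term. Terms depend on the coordinates only, so this
    one is 1 on the whole saturation, while it is below 1 near the point. *)
Lemma saturation_closed (F : set K) : compact F -> closed (saturation F).
Proof.
move=> cF x clx; apply: contrapT => nFx.
have [|y z Fy ->|t [t1 t0]] := term_separation F [set x] cF.
- exact: compact_set1.
- apply: contrapT => /forallNP uyx; apply: nFx; exists y => // i.
  by have /negP := uyx i; rewrite negbK => /eqP.
have : nbhs x (term t @^-1` [set r | r < 1]).
  apply: term_continuous; apply: open_nbhs_nbhs; split; first exact: open_lt.
  by rewrite /= t0.
move=> /clx[z [[y Fy zy]]] /=.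
by rewrite (term_eq t z y)// t1// ltxx.
Qed.
End lattice_terms.
Arguments saturation {R K kappa}.
Arguments term {R K kappa}.

(** * The two inequalities *)

Section strongly_determined_base.
Context (R : realType) (K : ptopologicalType).
Hypothesis compactK : compact [set: K].
Implicit Types (mu nu : PK R K).

Lemma closed_compact (F : set K) : closed F -> compact F.
Proof. by move=> cF; exact: subclosed_compact compactK _. Qed.

Lemma radon_closed_approx mu (U : set K) (d : R) : 0 < d ->
  measurable (U : set (borel K)) -> exists C : set K,
  [/\ closed C, C `<=` U & fine (val mu U) - d < fine (val mu C)].
Proof.
move=> d0 mU; have muR := set_mem (valP mu) U mU.
have fU : ereal_sup [set val mu F | F in [set F : set K | closed F /\ F `<=` U]]
    \is a fin_num.
  by rewrite -muR fin_num_measure.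
have [_ [C [cC CU] <-] dC] := ub_ereal_sup_adherent d0 fU.
exists C; split=> //.
rewrite -lte_fin EFinB !fineK ?fin_num_measure//; last exact: closed_borel.
by rewrite muR.
Qed.

Lemma mean_affine nu (g : K -> R) (a b : R) : continuous g ->
  mean nu (fun x => a * g x + b) = a * mean nu g + b.
Proof.
move=> cg; have ig := continuous_integrable _ _ compactK (val nu) _ cg.
rewrite /mean RintegralD//; last 2 first.
- apply: continuous_integrable => // x.
  by apply: cvgM; [exact: cvg_cst|exact: cg].
- by apply: continuous_integrable => // x; exact: cvg_cst.
by rewrite Rintegral_cstT RintegralZl.
Qed.

(** If [|g| <= M], then [(g / M + 1) / 2] has values in the unit interval. The slope is positive, so
    estimates and fibres carry back to [g]. *)
Lemma affine_unit_itv (g : K -> R) : continuous g ->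
  exists a b : R, 0 < a /\ forall x, 0 <= a * g x + b <= 1.
Proof.
move=> cg; have [M M0 gM] := continuous_bounded _ _ compactK _ cg.
exists (2 * M)^-1, (2^-1); split; first by rewrite invr_gt0 mulr_gt0.
move=> x; have := gM x; rewrite ler_norml => /andP[g1 g2].
rewrite invfM -mulrA.
have h1 : -1 <= M^-1 * g x by rewrite mulrC ler_pdivlMr// mulN1r.
have h2 : M^-1 * g x <= 1 by rewrite mulrC ler_pdivrMr// mul1r.
lra.
Qed.

Lemma strongly_determined_local_base (kappa : Type) mu :
  infinite_set [set: kappa] -> strongly_determined (val mu) kappa ->
  exists2 B, local_base mu B & (B #<= [set: kappa])%card.
Proof.
move=> infk [f [cf muf]].
pose I01 := set_type (`[0%R, 1%R]%classic : set R).
pose u (i : kappa) (x : K) : R := val (f x i).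
have cu i : continuous (u i).
  move=> x.
  have /cvg_sup/(_ i) cfi := cf x.
  have c1 := @initial_continuous _ _ (fun h : {ptws kappa -> I01} => h i) (f x).
  have c2 := @initial_continuous _ _ (val : I01 -> R) (f x i).
  have c3 := @cvg_comp _ _ _ f (fun h => h i) _ _ _ cfi c1.
  exact: (@cvg_comp _ _ _ (fun x => f x i) val _ _ _ c3 c2).
have satE F : f @^-1` (f @` F) = saturation u F.
  apply/seteqP; split=> x /=.
    by move=> [y Fy fyx]; exists y => // i; rewrite /u fyx.
  move=> [y Fy uxy]; exists y => //; apply/funext => i.
  by apply: val_inj; exact/esym/uxy.
have {}muf F : compact F -> val mu F = val mu (saturation u F).
  by move=> /muf ->; rewrite satE.
have ct t := term_continuous _ _ _ _ cu t.
pose B := range (basic_nbhs (term u) mu).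
have BF := basic_nbhs_filter _ _ _ (term u) mu.
set Fl := filter_from _ _ in BF.
(* A closed [C] fills the complement of the saturation up to [d / 2]. A term that is 1 on [F] and 0
   on [C] has [mu]-integral at most [mu F + d / 2], and the tolerance for [nu] absorbs the other
   half. *)
have closed_upper (F : set K) (d : R) : closed F -> 0 < d ->
    Fl [set nu : PK R K | fine (val nu F) <= fine (val mu F) + d].
  move=> cF d0; have cptF := closed_compact _ cF.
  have clE : closed (saturation u F) by exact: saturation_closed.
  have mE := closed_borel _ _ clE.
  have d2 : 0 < d / 2 by lra.
  have [C [cC CE dC]] := radon_closed_approx mu (~` saturation u F)
    (d / 2) d2 (measurableC mE).
  have [x y Fx Cy|t [t1 t0]] := term_separation _ _ _ u cu F C cptF
    (closed_compact _ cC).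
    apply: contrapT => /forallNP nu_xy; apply: (CE _ Cy); exists x => // i.
    by have /negP := nu_xy i; rewrite negbK eq_sym => /eqP.
  have [n nd] : exists n : nat, n.+1%:R^-1 < d / 2.
    have [n _ nP] := near_infty_natSinv_lt (PosNum d2).
    by exists n; exact: nP n (leqnn n).
  exists ([:: t], n) => // nu nuB.
  have nut : `|mean nu (term u t) - mean mu (term u t)| < n.+1%:R^-1.
    by move: nuB; rewrite /basic_nbhs/= andbT.
  suff : fine (val nu F) <= fine (val mu F) + d by [].
  have h1 : fine (val nu F) <= mean nu (term u t).
    apply: Rintegral_ge_closed => //.
      by move=> x; have /andP[] := term_itv _ _ _ u t x.
    by move=> x /t1 ->.
  have h2 : mean mu (term u t) <= 1 - fine (val mu C).
    apply: Rintegral_le_closed => //.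
      by move=> x; have /andP[] := term_itv _ _ _ u t x.
    by move=> x /t0 ->.
  have h3 : fine (val mu (~` saturation u F)) =
      1 - fine (val mu (saturation u F)).
    exact: fine_probability_setC.
  move: nut; rewrite ltr_norml (muf _ cptF) => /andP[_ nut].
  have arith (nF mnu mmu C' E cE k : R) : nF <= mnu ->
      mmu <= 1 - C' -> cE = 1 - E ->
      mnu - mmu < k -> k < d / 2 -> cE - d / 2 < C' -> nF <= E + d by lra.
  exact: arith h1 h2 h3 nut nd dC.
(* Only finitely many slices occur, so [closed_upper] holds for all of them at once in the filter.
   Half of [d] pays for the slices, half for the discretisation [1/(n+1)]. *)
have upper (g : K -> R) (d : R) : continuous g ->
    (forall x, 0 <= g x <= 1) -> 0 < d ->
    Fl [set nu | mean nu g <= mean mu g + d].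
  move=> cg g01 d0.
  have d2 : 0 < d / 2 by lra.
  have [n nd] : exists n : nat, n.+1%:R^-1 < d / 2.
    have [n _ nP] := near_infty_natSinv_lt (PosNum d2).
    by exists n; exact: nP n (leqnn n).
  have cFk k : closed [set x | k.+1%:R <= n.+1%:R * g x].
    have -> : [set x | k.+1%:R <= n.+1%:R * g x] =
      (fun x => n.+1%:R * g x) @^-1` [set r | k.+1%:R <= r] by [].
    apply: closed_comp => // x _; apply: cvgM; [exact: cvg_cst|exact: cg].
  pose S (k : 'I_n.+1) := [set nu : PK R K |
    fine (val nu [set x | k.+1%:R <= n.+1%:R * g x]) <=
    fine (val mu [set x | k.+1%:R <= n.+1%:R * g x]) + d / 2].
  have /(filter_forall BF) : forall k, Fl (S k) by move=> k; exact: closed_upper.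
  apply: (@filterS _ _ BF) => nu nuF /=.
  have nug : mean nu g <= mean mu g + d / 2 + n.+1%:R^-1.
    apply: (Rintegral_le_of_superlevel _ _ compactK) => // k kn.
    exact: (nuF (Ordinal kn)).
  have dd : d = d / 2 + d / 2 by lra.
  by rewrite (le_trans nug)// [in leRHS]dd addrA lerD2l ltW.
exists B; last first.
  apply: card_le_trans (card_image_le _ _) _; apply/card_le_setTP.
  have [p pinj] := infinite_square _ infk; have [q qinj] := infinite_seq _ infk.
  have /infiniteP/card_le_setTP[e einj] := infk.
  (* The index of a member of [B] is coded in stages: [i2] codes atoms, [i3] clauses, [i4] terms and
     [i5] lists of terms; the tolerance is added last. *)
  have lift (A : Type) (i : A -> kappa) : injective i ->
      exists j : seq A -> kappa, injective j.
    by move=> iinj; exists (q \o map i);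
      exact: inj_comp qinj (map_injective _ _ _ iinj).
  have pairing (A A' : Type) (i : A -> kappa) (i' : A' -> kappa) :
      injective i -> injective i' -> exists j : A * A' -> kappa, injective j.
    move=> iinj i'inj; exists (p \o (fun z => (i z.1, i' z.2))).
    exact: inj_comp pinj (inj_pair _ _ _ _ _ _ iinj i'inj).
  have rinj : injective (e \o pickle : rat -> kappa).
    exact: inj_comp einj (pcan_inj pickleK).
  have [i1 i1inj] := pairing _ _ _ _ (@inj_id kappa) rinj.
  have [i2 i2inj] := pairing _ _ _ _ i1inj rinj.
  have [i3 i3inj] := lift _ _ i2inj.
  have [i4 i4inj] := lift _ _ i3inj.
  have [i5 i5inj] := lift _ _ i4inj.
  exact: pairing i5inj einj.
split; first by move=> _ [p _ <-]; exact: basic_nbhs_open.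
have : Fl --> mu.
  apply: cvg_PK => g e e0; have cg := @cts_fun _ _ g.
  have [a [b [a0 ab]]] := affine_unit_itv _ cg.
  (* Means of the normalised function scale by [a]. The upper bounds for it and for its complement
     to 1 are not strict, hence half of [a * e]. *)
  have d0 : 0 < a * e / 2 by rewrite divr_gt0 ?mulr_gt0.
  have ca c c' : continuous (fun x => c * g x + c').
    move=> x; apply: cvgD; last exact: cvg_cst.
    by apply: cvgM; [exact: cvg_cst|exact: cg].
  have up1 := upper _ _ (ca a b) ab d0.
  have up2 := upper (fun x => (- a) * g x + (1 - b)) _ (ca (- a) (1 - b)) _ d0.
  have {}up2 := up2 (fun x => ltac:(have := ab x; lra)).
  apply: filterS2 up1 up2 => nu /=; rewrite !mean_affine// => h1 h2.
  rewrite -(ltr_pM2l a0) -[X in X * `|_|]gtr0_norm// -normrM ltr_norml.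
  have : 0 < a * e by rewrite mulr_gt0.
  rewrite mulrBr; lra.
move=> FlV V /FlV[p _ pV]; exists (basic_nbhs (term u) mu p) => //.
by exists p.
Qed.
End strongly_determined_base.

(** * Borel maps with finitely many values, and their image measures *)

Section finite_range_maps.
Context (K : ptopologicalType).

(** Preimages of arbitrary sets are required to be Borel; the property holds for constants and
    survives Borel case distinctions. *)
Definition borel_simple (s : K -> K) : Prop :=
  finite_set (range s) /\
  forall B : set K, measurable (s @^-1` B : set (borel K)).

Lemma borel_simple_cst (a : K) : borel_simple (fun=> a).
Proof.
split; first by apply: sub_finite_set (finite_set1 a) => _ [x _ <-].
by move=> B; rewrite preimage_cst; case: ifP.
Qed.

Lemma borel_simple_if (A : set K) (s1 s2 : K -> K) :
  measurable (A : set (borel K)) -> borel_simple s1 -> borel_simple s2 ->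
  borel_simple (fun x => if x \in A then s1 x else s2 x).
Proof.
move=> mA [f1 m1] [f2 m2]; split.
  have : finite_set (range s1 `|` range s2) by rewrite finite_setU.
  apply: sub_finite_set => _ [x _ <-].
  by case: ifP => _; [left|right]; exists x.
move=> B; have -> : (fun x => if x \in A then s1 x else s2 x) @^-1` B =
    (A `&` s1 @^-1` B) `|` (~` A `&` s2 @^-1` B).
  apply/seteqP; split=> x /=.
    by case: (boolP (x \in A)) => [/set_mem Ax|]; [left|rewrite notin_setE; right].
  by move=> [[Ax]|[nAx]]; [rewrite mem_set|rewrite memNset].
by apply: measurableU; apply: measurableI => //; exact: measurableC.
Qed.
End finite_range_maps.

Section local_base_determined.
Context (R : realType) (K : ptopologicalType).
Hypotheses (compactK : compact [set: K]) (hausdorffK : hausdorff_space K).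
Implicit Types (mu nu : PK R K).

(** The image measure lives on the finite range of [s]. It is Radon because the part of [B] in that
    range is closed, [K] being Hausdorff, and has the full measure of [B]. *)
Lemma borel_simple_pushforward mu (s : K -> K) : borel_simple K s ->
  exists nu, (forall B : set K, val nu B = val mu (s @^-1` B)) /\
    forall g, continuous g -> mean nu g = \int[val mu]_x g (s x).
Proof.
move=> [fs ms].
have mfs : measurable_fun (setT : set (borel K)) (s : borel K -> borel K).
  by move=> _ B _; rewrite setTI.
pose X : {mfun borel K >-> borel K} :=
  MeasurableFun.Pack (MeasurableFun.Class (isMeasurableFun.Build _ _ _ _ _ mfs)).
pose nu : probability (borel K) R := distribution (val mu) X.
have nuE B : nu B = val mu (s @^-1` B) by [].
have radon_nu : radon nu.
  move=> B mB; apply/eqP; rewrite eq_le; apply/andP; split.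
    apply: ereal_sup_ubound; exists (B `&` range s); first split.
    - have /accessible_finite_set_closed := hausdorff_accessible hausdorffK; apply.
      by apply: sub_finite_set fs; exact: subIsetr.
    - exact: subIsetl.
    - rewrite !nuE; congr (val mu _); apply/seteqP; split=> x /=; first by case.
      by move=> Bx; split=> //; exists x.
  apply: ub_ereal_sup => _ [F [cF FB] <-].
  by apply: le_measure => //; rewrite inE//; exact: closed_borel.
exists (SigSub (mem_set (radon_nu : [set m : probability (borel K) R | radon m] nu))
  : PK R K); split=> // g cg.
have mg := continuous_borel _ _ _ cg.
have [M _ gM] := continuous_bounded _ _ compactK _ cg.
rewrite /mean /Rintegral/= integral_pushforward//.
- exact/measurable_EFinP.
- apply: (bounded_integrable _ _ (val mu) (g \o s) M) => [|x]; last exact: gM.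
  exact: measurableT_comp mg mfs.
Qed.

(** Compactness cuts [K] into finitely many pieces on which the functions of [s] are almost
    constant. In each piece, points of [E] are sent to one point of [F] with nearly the same values,
    and all other points to the centre. *)
Lemma exists_pushforward_into mu (E F : set K) (s : seq (continuousType K R))
    (e : R) :
  closed E -> closed F -> 0 < e ->
  (forall x, E x ->
    exists2 y, F y & all (fun g : continuousType K R => g x == g y) s) ->
  exists nu, all (fun g : continuousType K R => `|mean nu g - mean mu g| < e) s /\
    fine (val mu E) <= fine (val nu F).
Proof.
move=> cE cF e0 EF.
pose U x := [set z | all (fun g : continuousType K R => `|g z - g x| < e / 4) s].
have e4 : 0 < e / 4 by rewrite divr_gt0.
have oU x : open (U x).
  rewrite /U; clear U EF; elim: s => [|g s IH].
    by rewrite (_ : [set _ | _] = setT) ?predeqE//; exact: openT.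
  rewrite (_ : [set _ | _] = (g @^-1` ball (g x) (e / 4)) `&`
    [set z | all (fun g : continuousType K R => `|g z - g x| < e / 4) s]).
    apply: openI => //; apply: open_comp; last exact: ball_open.
    by move=> z _; exact: cts_fun.
  apply/seteqP; split=> z /=; rewrite /ball/= distrC; first by move/andP.
  by move=> ?; exact/andP.
have Uxx x : U x x.
  by rewrite /U/=; clear U oU EF; elim: s => //= g s ->; rewrite subrr normr0 e4.
(* A pair consists of a centre and a target in [F] for the points of [E] near it. Two points within
   [e / 4] of the centre values differ by less than [e / 2]. *)
pose Q (a : K * K) := forall y, U a.1 y -> E y -> F a.2 /\
  all (fun g : continuousType K R => `|g a.2 - g y| < e / 2) s.
have triang (p q r : R) : `|p - r| < e / 4 -> `|q - r| < e / 4 -> `|p - q| < e / 2.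
  move=> h1 h2; rewrite (le_lt_trans (ler_distD r p q))// [`|r - q|]distrC.
  lra.
have [x _|l [Ql Ul]] := compact_subcover_seq _ _ Q setT (fun a => U a.1) compactK.
  have [[y [Uy Ey]]|nUE] := pselect (exists y, U x y /\ E y); last first.
    (* No point of [E] is near [x], so any target will do. *)
    exists (x, x); split; last by apply: open_nbhs_nbhs; split.
    by move=> y Uy Ey; case: nUE; exists y.
  have [c Fc gc] := EF y Ey.
  exists (x, c); split; last by apply: open_nbhs_nbhs; split.
  move=> z /= Uz Ez; split=> //.
  move: Uy Uz gc; rewrite /U/=; clear U EF oU Uxx Q; elim: s => //= g s IH.
  move=> /andP[gy sy] /andP[gz sz] /andP[/eqP <- sc].
  by rewrite (triang _ _ (g x))// IH.
(* The first listed neighbourhood containing [y] decides. The default [point] is never reached for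
   [l], which covers [K]. *)
pose fs (l : seq (K * K)) (y : K) := foldr (fun a acc =>
  if y \in U a.1 then (if y \in E then a.2 else a.1) else acc) point l.
have mE := closed_borel _ _ cE.
have simple_fs l' : borel_simple K (fs l').
  elim: l' => [|a l' IH]; first exact: borel_simple_cst.
  apply: (borel_simple_if _ (U a.1)
    (fun y => if y \in E then a.2 else a.1) (fs l')) => //.
    exact: open_borel.
  by apply: borel_simple_if => //; exact: borel_simple_cst.
have fsP y : (E y -> F (fs l y)) /\
    all (fun g : continuousType K R => `|g (fs l y) - g y| < e / 2) s.
  move: (Ul y I); clear Ul; elim: l Ql => //= a l' IH /andP[/asboolP Qa Ql'] Ual.
  move: Ual.
  case: (boolP (y \in U a.1)) => [/set_mem Uy _|/negP nUy].
    case: (boolP (y \in E)) => [/set_mem Ey|/negP nEy].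
      by have [] := Qa y Uy Ey.
    split; first by move=> /mem_set.
    move: Uy; rewrite /U/=; apply: sub_all => g gy.
    by rewrite distrC (lt_trans gy)//; lra.
  by move=> /orP[/asboolP/mem_set//|/(IH Ql')].
have [nu [nuE nuI]] := borel_simple_pushforward mu _ (simple_fs l).
exists nu; split; last first.
  rewrite nuE fine_le ?fin_num_measure//; [exact: (simple_fs l).2|].
  by apply: le_measure; rewrite ?inE//; [exact: (simple_fs l).2|move=> y /(fsP y).1].
have {}fsP y := (fsP y).2.
have mfs : measurable_fun (setT : set (borel K)) (fs l : borel K -> borel K).
  by move=> _ B _; rewrite setTI; exact: (simple_fs l).2.
have mean_close (g : continuousType K R) :
    (forall y, `|g (fs l y) - g y| < e / 2) ->
    `|mean nu g - mean mu g| < e.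
  move=> gl; have cg := @cts_fun _ _ g.
  have ig := continuous_integrable _ _ compactK (val mu) _ cg.
  have [M _ gM] := continuous_bounded _ _ compactK _ cg.
  have igs : (val mu).-integrable setT (EFin \o (fun x => g (fs l x))).
    apply: (bounded_integrable _ _ (val mu) (fun x => g (fs l x)) M) => // .
    exact: measurableT_comp (continuous_borel _ _ _ cg) mfs.
  rewrite nuI// /mean -RintegralB//.
  have e2 : e / 2 < e by lra.
  rewrite (le_lt_trans _ e2)// -[leRHS](Rintegral_cstT _ _ (val mu)).
  have igB : (val mu).-integrable setT (EFin \o (fun x => g (fs l x) - g x)).
    by have := integrableB measurableT igs ig.
  apply: le_trans (le_normr_Rintegral measurableT igB) _.
  apply: le_Rintegral => //.
  - by have := integrable_abse igB.
  - by apply: continuous_integrable => // x; exact: cvg_cst.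
  - by move=> x _; exact/ltW.
apply/allP => g gs; apply: mean_close => y.
by have /allP := fsP y; apply.
Qed.
End local_base_determined.

(** * From a local base to strong determination *)

Section determined_of_local_base.
Context (R : realType) (K : ptopologicalType).
Hypotheses (compactK : compact [set: K]) (hausdorffK : hausdorff_space K).

Lemma local_base_strongly_determined (kappa : Type) (mu : PK R K)
    (B : set (set (PK R K))) :
  infinite_set [set: kappa] -> local_base mu B -> (B #<= [set: kappa])%card ->
  strongly_determined (val mu) kappa.
Proof.
move=> infk [Bmu Bcvg] Bk.
pose I01 := set_type (`[0%R, 1%R]%classic : set R).
pose ev (g : continuousType K R) : K -> R := g.
have cev g : continuous (ev g) by exact: cts_fun.
have Bbasic (b : set_type B) : exists p : seq (continuousType K R) * nat,
    basic_nbhs ev mu p `<=` val b.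
  have FF := basic_nbhs_filter R K _ ev mu.
  have Fmu : filter_from setT (basic_nbhs ev mu) --> mu.
    apply: cvg_PK => g e e0.
    have [n _ nP] := near_infty_natSinv_lt (PosNum e0).
    exists ([:: g], n) => // nu; rewrite /basic_nbhs/= andbT => /lt_trans; apply.
    exact: nP n (leqnn n).
  have [|p _ pb] := Fmu (val b); last by exists p.
  by apply: open_nbhs_nbhs; apply: Bmu; exact: (set_mem (valP b)).
have {Bbasic}[p pB] := choice Bbasic.
have [J Jinj] : exists J : set_type B * nat -> kappa, injective J.
  have /card_le_setTP[h hinj] : ([set: set_type B] #<= [set: kappa])%card.
    by apply: card_le_trans Bk; have /card_eqPle[] := card_setT B.
  have /infiniteP/card_le_setTP[e einj] := infk.
  have [q qinj] := infinite_square _ infk.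
  exists (q \o (fun z => (h z.1, e z.2))).
  exact: inj_comp qinj (inj_pair _ _ _ _ _ _ hinj einj).
have c0 : continuous (fun _ : K => 0 : R) by move=> x; exact: cvg_cst.
pose zero : continuousType K R := mkcts c0.
(* Coordinate [J (b, j)] is the [j]-th function attached to [b]. The function [zero] fills positions
   past the end of a list and indices outside the range of [J]. *)
have wP (k : kappa) : exists g : continuousType K R, forall b j, J (b, j) = k ->
    g = nth zero (p b).1 j.
  have [[[b j] bjk]|nk] := pselect (exists bj, J bj = k); last first.
    by exists zero => b j bjk; case: nk; exists (b, j).
  exists (nth zero (p b).1 j) => b' j'; rewrite -bjk => /Jinj.
  by case=> -> ->.
have {wP}[w wP] := choice wP.
(* Each coordinate is moved into the unit interval by an injective affine map, which leaves the
   fibres unchanged. *)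
have nP (k : kappa) : exists c : R * R, 0 < c.1 /\
    forall x, `[0%R, 1%R]%classic (c.1 * ev (w k) x + c.2).
  have [a [b [a0 ab]]] := affine_unit_itv _ _ compactK _ (cev (w k)).
  by exists (a, b); split=> // x; rewrite /= in_itv/=; exact: ab.
have {nP}[c cP] := choice nP.
pose f (x : K) : {ptws kappa -> I01} :=
  fun k => SigSub (mem_set ((cP k).2 x)).
have cfk k : continuous (f : K -> initial_topology
    (fun h : {ptws kappa -> I01} => h k)).
  apply: continuous_comp_initial.
  apply: (@continuous_comp_initial _ _ R (val : I01 -> R)).
  move=> z; apply: cvgD; last exact: cvg_cst.
  by apply: cvgM; [exact: cvg_cst|exact: cev].
have cf : continuous f by move=> x; apply/cvg_sup => k; exact: cfk.
exists f; split=> // F cptF.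
pose u k := ev (w k).
have satE : f @^-1` (f @` F) = saturation u F.
  apply/seteqP; split=> x /= [y Fy].
    move=> fyx; exists y => // k.
    have := congr1 (fun h : kappa -> I01 => val (h k)) fyx.
    move=> /addIr/mulfI h; apply/esym/h.
    by rewrite gt_eqF//; have [] := cP k.
  move=> uxy; exists y => //; apply/funext => k; apply: val_inj => /=.
  by rewrite -/(u k) -uxy.
rewrite satE.
have cu k : continuous (u k) by exact: cev.
have cE : closed (saturation u F) by exact: saturation_closed.
have cF : closed F by exact: compact_closed.
have mE := closed_borel _ _ cE; have mF := closed_borel _ _ cF.
have FE : F `<=` saturation u F by move=> x Fx; exists x.
apply/eqP; rewrite eq_le le_measure ?inE//=.
rewrite -[leLHS]fineK ?fin_num_measure// -[leRHS]fineK ?fin_num_measure// lee_fin.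
apply/ler_addgt0Pr => e e0; have e2 : 0 < e / 2 by rewrite divr_gt0.
(* The Urysohn function that is 0 on [C] and 1 on [F] will have [mu]-integral below
   [mu F + e / 2]. *)
have [C [cC CF dC]] := radon_closed_approx _ _ mu (~` F) (e / 2) e2 (measurableC mF).
have sepCF : uniform_separator C F.
  apply: normal_uniform_separator => //; first exact: compact_normal.
  by apply/seteqP; split=> // x [/CF].
pose phi : K -> R := Urysohn C F.
have cphi : continuous phi by exact: Urysohn_continuous.
have phi01 x : 0 <= phi x <= 1.
  by have /(_ (phi x)) := @Urysohn_range _ R C F; rewrite /= in_itv/=; apply; exists x.
have phiC x : C x -> phi x = 0.
  by move=> Cx; have /(_ (phi x)) := @Urysohn_sub0 _ R C F sepCF; apply; exists x.
have phiF x : F x -> phi x = 1.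
  by move=> Fx; have /(_ (phi x)) := @Urysohn_sub1 _ R C F sepCF; apply; exists x.
have [b Bb bphi] : filter_from B id
    [set nu : PK R K | `|mean nu phi - mean mu phi| < e / 2].
  apply: Bcvg; have := mean_continuous _ _ _ cphi mu.
  move=> /(_ (ball (mean mu phi) (e / 2)) (nbhsx_ballx _ _ e2)) ballmu.
  by apply: (@filterS _ (nbhs mu) _ _ _ _ ballmu) => nu; rewrite /ball/= distrC.
pose b' : set_type B := SigSub (mem_set Bb).
(* Points related by the saturation agree on all functions attached to [b'], so [mu] can be pushed
   into [F] without leaving the basic neighbourhood inside [b']. *)
have [|x [y Fy uxy]|nu [nuB nuE]] := exists_pushforward_into R K compactK
    hausdorffK mu (saturation u F) F (p b').1 ((p b').2.+1%:R^-1) cE cF _.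
- by rewrite invr_gt0 ltr0n.
- exists y => //; apply/(all_nthP zero) => j _.
  by have := uxy (J (b', j)); rewrite /u /ev (wP _ b' j)// => ->.
have /bphi nuphi : val b' nu by exact: (pB b' nu).
have h1 : fine (val nu F) <= mean nu phi.
  apply: Rintegral_ge_closed => // x; first by have /andP[] := phi01 x.
  by move=> /phiF ->.
have h2 : mean mu phi <= 1 - fine (val mu C).
  apply: Rintegral_le_closed => // x; first by have /andP[] := phi01 x.
  by move=> /phiC ->.
have h3 : fine (val mu (~` F)) = 1 - fine (val mu F).
  exact: fine_probability_setC.
have h4 : mean nu phi - mean mu phi < e / 2.
  by rewrite (le_lt_trans _ nuphi)// ler_norm.
have arith (nF mnu mmu C' E cF' F' : R) : nF <= mnu ->
  mmu <= 1 - C' -> cF' = 1 - F' ->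
  mnu - mmu < e / 2 -> E <= nF -> cF' - e / 2 < C' -> E <= F' + e by lra.
exact: arith h1 h2 h3 h4 nuE dC.
Qed.
End determined_of_local_base.

Theorem theorem3p5 (R : realType) (K : ptopologicalType)
    (compactK : compact [set: K]) (hausdorffK : hausdorff_space K)
    (mu : PK R K) :
  exists kappa : Type, is_character mu kappa /\ is_sd (val mu) kappa.
Proof.
pose P (L : Type) := exists2 B, local_base mu B & (B #<= [set: L])%card.
(* The left summand bounds the base of all open neighbourhoods; the right one makes the type
   infinite. *)
have [A B AB [B' lB' B'A]|||kappa [infk Pk kmin]] :=
    exists_least_infinite_cardinal P (set (PK R K) + nat)%type.
- by exists B' => //; apply: card_le_trans B'A _; exact/card_le_setTP.
- by apply/infiniteP/card_le_setTP; exists inr => x y [].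
- exists (open_nbhs mu).
    by split=> // V; rewrite nbhsE => -[U Umu UV]; exists U.
  apply: card_le_trans (card_leT _) _; apply/card_le_setTP.
  by exists inl => x y [].
exists kappa; split; split=> //.
  by have [B lB Bk] := Pk; apply: local_base_strongly_determined lB Bk.
move=> L infL sdL; apply: kmin => //.
exact: strongly_determined_local_base sdL.
Qed.
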